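(* Let $d\ge 1$, $R>0$, $\sigma\ge 0$, $\Delta>0$, $\tau>0$, and let $g:\mathbb R\to\mathbb R$ be $1$-Lipschitz and monotonically non-decreasing. Fix a distribution of $x$ supported in the unit ball of $\mathbb R^d$. Suppose the problem $\text{GLM-Ob}(g,\sigma,w^* )$ is not $(\Delta,\tau)$-identifiable, i.e., there exist $u,v\in\mathbb R^d$ and $A\in\mathbb R$ such that $u,v$ are $\Delta$-separated and $\Pr_x\left[\,|g(u\cdot x)-g(v\cdot x)-A|>\tau\,\right]\le\tau$. Then any algorithm that, from i.i.d. samples $(x,y)$ of $\text{GLM-Ob}(g,\sigma,w^* )$, distinguishes between $w^*=u$ and $w^*=v$ with probability at least $1-\delta$ requires $m=\Omega\left(\min(\sigma,1)\ln(1/\delta)/\tau\right)$ samples.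
   Context: $(x,y)\sim\text{GLM-Ob}(g,\sigma,w^* )$ means: $x\in\mathbb R^d$ is drawn from some distribution supported in the unit ball $\{\|x\|_2\le 1\}$, and $y=g(w^*\cdot x)+\xi+\epsilon$, where $\xi$ (the ''oblivious noise'') and $\epsilon$ are drawn independently of $x$, $\xi$ has an arbitrary distribution with $\Pr[\xi=0]\ge\alpha$ for some $\alpha>0$, and $\epsilon\sim\mathcal N(0,\sigma^2)$; moreover $\|w^*\|_2\le R$ and $g$ is $1$-Lipschitz and monotonically non-decreasing. Two vectors $u,v$ are $\Delta$-separated if $\mathbb E_x\left[|g(u\cdot x)-g(v\cdot x)|\right]>\Delta$. An instance is $(\Delta,\tau)$-identifiable if any two $\Delta$-separated $u,v$ satisfy $\Pr_x\left[|g(u\cdot x)-g(v\cdot x)-A|>\tau\right]>\tau$ for all $A\in\mathbb R$.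
   Formalization: Assumes α ≤ 1/2, with the algorithm correct for every noise with Pr[ξ=0] ≥ α (for α > 1/2 a majority vote can refute the bound), and δ ≤ δ₀ < 1/2 with the Ω constant depending only on δ₀ (at δ = 1/2 a coin flip needs no samples). *)

(* Defs.v *)
From HB Require Import structures.
From mathcomp Require Import all_boot all_order all_algebra.
From mathcomp Require Import all_classical all_reals all_analysis.

Set Implicit Arguments.
Unset Strict Implicit.
Unset Printing Implicit Defensive.
Import Order.TTheory GRing.Theory Num.Theory.
Import numFieldNormedType.Exports.

Local Open Scope classical_set_scope.
Local Open Scope ring_scope.

Section iid.
Context {d : measure_display} {T : measurableType d} {R : realType}.
Variable P : probability T R.

Definition tuple_cons (n : nat) (z : T * n.-tuple T) : n.+1.-tuple T :=
  [tuple of z.1 :: z.2].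

Lemma measurable_tuple_cons (n : nat) :
  measurable_fun [set: T * n.-tuple T] (@tuple_cons n).
Proof. exact: measurable_cons. Qed.

HB.instance Definition _ (n : nat) :=
  isMeasurableFun.Build _ _ _ _ (@tuple_cons n) (@measurable_tuple_cons n).

(* The law of n independent draws from P; see iid_box. *)
Fixpoint iid (n : nat) : probability (n.-tuple T) R :=
  match n with
  | 0 => \d_[tuple]
  | n'.+1 => distribution (P \x iid n')%E (@tuple_cons n')
  end.

Lemma measurable_box (n : nat) (B : 'I_n -> set T) :
  (forall i, measurable (B i)) ->
  measurable [set t : n.-tuple T | forall i, B i (tnth t i)].
Proof.
move=> mB.
rewrite (_ : [set _ | _] =
    \bigcap_(i in [set: 'I_n]) ((fun t : n.-tuple T => tnth t i) @^-1` B i)).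
  apply: fin_bigcap_measurable => // i _; rewrite -[X in measurable X]setTI.
  exact: measurable_tnth.
by apply/seteqP; split=> t /= tB i => [_|]; exact: tB.
Qed.

Lemma iid_box (n : nat) (B : 'I_n -> set T) :
  (forall i, measurable (B i)) ->
  iid n [set t : n.-tuple T | forall i, B i (tnth t i)] =
  (\prod_(i < n) P (B i))%E.
Proof.
elim: n B => [|n IH] B mB.
  rewrite big_ord0 /= diracE mem_set//= => i.
  by case: i.
rewrite big_ord_recl /= /distribution /pushforward.
rewrite (_ : _ @^-1` _ =
    B ord0 `*` [set t : n.-tuple T | forall i, B (lift ord0 i) (tnth t i)]).
  rewrite product_measure1E//.
    by congr (_ * _)%E; exact: (IH (fun i => B (lift ord0 i))).
  exact: (@measurable_box n (fun i => B (lift ord0 i))).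
apply/seteqP; split=> -[x t] /= => [h|[h0 hS] i].
  split; first by have := h ord0; rewrite tnth0.
  by move=> i; have := h (lift ord0 i); rewrite tnthS.
by case: (unliftP ord0 i) => [j|] ->; rewrite ?tnthS ?tnth0.
Qed.

End iid.

Section gaussian.
Context {R : realType}.

(* normal_prob lives on measurableTypeR R, which has the same measurable sets
   as R but another display; realR changes the display. *)
Definition realR (x : measurableTypeR R) : R := x.

Lemma measurable_realR : measurable_fun setT realR.
Proof. by move=> _ B mB; rewrite setTI. Qed.

HB.instance Definition _ :=
  isMeasurableFun.Build _ _ _ _ realR measurable_realR.

(* sigma is the standard deviation. N(0, 0) is the point mass at 0, whereas
   normal_prob 0 0 is the uniform law on [0, 1]. *)
Definition centered_normal (sigma : R) : probability R R :=
  if sigma == 0 then (\d_(0 : R) : probability R R)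
  else distribution (normal_prob 0 sigma) realR.

End gaussian.

Section glm.
Context {R : realType} {d : nat}.
Implicit Types (w u v x : d.-tuple R) (g : R -> R).

(* R^d is d.-tuple R with the library's product sigma-algebra. *)
Definition dotp w x : R := \sum_(i < d) tnth w i * tnth x i.

Definition l2norm w : R := Num.sqrt (\sum_(i < d) tnth w i ^+ 2).

Definition supported_in_unit_ball (D : probability (d.-tuple R) R) :=
  D [set x | l2norm x <= 1] = 1%E.

Definition glm_separated (D : probability (d.-tuple R) R) g (Delta : R) u v :=
  (Delta%:E < 'E_D[fun x => (`|g (dotp u x) - g (dotp v x)|)%R])%E.

Definition gap_prob (D : probability (d.-tuple R) R) g (tau : R) u v (A : R) :=
  D [set x | `|g (dotp u x) - g (dotp v x) - A| > tau].

Definition glm_identifiable (D : probability (d.-tuple R) R) g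
    (Delta tau : R) :=
  forall u v, glm_separated D g Delta u v ->
  forall A : R, (gap_prob D g tau u v A > tau%:E)%E.

Lemma not_glm_identifiableP (D : probability (d.-tuple R) R) g (Delta tau : R) :
  ~ glm_identifiable D g Delta tau <->
  exists u v A,
    glm_separated D g Delta u v /\ (gap_prob D g tau u v A <= tau%:E)%E.
Proof.
split=> [/existsNP[u /existsNP[v /not_implyP[uv /existsNP[A /negP]]]]|].
  by rewrite -leNgt => uvA; exists u, v, A.
by move=> [u [v [A [uv uvA]]]] /(_ u v uv A); rewrite ltNge uvA.
Qed.

Definition glm_draw g w (z : d.-tuple R * R * R) : d.-tuple R * R :=
  let: (x, xi, eps) := z in (x, g (dotp w x) + xi + eps).

(* An m-sample algorithm with a binary answer is a Markov kernel, so internal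
   randomness is allowed. *)
Definition algorithm (m : nat) :=
  R.-pker (m.-tuple (d.-tuple R * R)%type) ~> bool.

(* The probability that alg answers b on m i.i.d. samples of GLM-Ob(g, sigma, w)
   with covariate law D and oblivious noise law Xi. *)
Definition answer_prob (D : probability (d.-tuple R) R) (Xi : probability R R)
    (sigma : R) g w (m : nat) (alg : algorithm m) (b : bool) : \bar R :=
  (\int[iid ((D \x Xi) \x centered_normal sigma) m]_z
     alg (map_tuple (glm_draw g w) z) [set b])%E.

(* The answers true and false stand for w = u and w = v. The algorithm must be
   correct for every oblivious noise law with an atom of mass at least alpha
   at 0, which need not be the same law under the two hypotheses. *)
Definition distinguishes (D : probability (d.-tuple R) R) g (sigma alpha : R)
    u v (delta : R) (m : nat) (alg : algorithm m) :=
  forall Xi : probability R R, (alpha%:E <= Xi [set 0%R])%E ->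
    ((1 - delta)%:E <= answer_prob D Xi sigma g u alg true)%E /\
    ((1 - delta)%:E <= answer_prob D Xi sigma g v alg false)%E.

End glm.

(* Main.v *)
Require Import Defs.
From HB Require Import structures.
From mathcomp Require Import all_boot all_order all_algebra.
From mathcomp Require Import all_classical all_reals all_analysis.
From mathcomp Require Import measurable_realfun lra ring.
Import Order.TTheory GRing.Theory Num.Theory.
Import numFieldNormedType.Exports.
Local Open Scope classical_set_scope.
Local Open Scope ring_scope.

(** The overlap of two laws is one minus their total variation distance. Under
    [u] let the oblivious noise be uniform on [{0, -A}] and under [v] uniform on
    [{A, 0}]. Outside an event of probability [tau] the two responses are then
    equal mixtures of Gaussians of standard deviation [sigma] whose centres are
    pairwise [tau]-close, so the overlap of one sample is at least
    [(1 - tau) (1 - tau / sigma)]. When [tau] is not small against [min sigma 1] this is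
    useless; instead, under both hypotheses, half of the noise is a Gaussian wide enough to hide the bounded
    difference of the responses, and the overlap of one sample is at least
    [1/4]. Overlaps multiply over independent samples, and an algorithm of error
    [delta] forces the overlap of [m] samples to be at most [2 delta]. *)

(* Tested on indicators, this says that the total variation distance between the
   images of P1 under h1 and of P2 under h2 is at most 1 - q. Quantifying over
   pairs of functions f + k >= c makes tensorization an iterated integral. *)
Definition overlap {R : realType} {d1 d2 : measure_display}
    {T : measurableType d1} {S : measurableType d2}
    (P1 P2 : {measure set T -> \bar R}) (h1 h2 : T -> S) (q : R) :=
  forall (c : R) (f k : S -> \bar R), 0 <= c ->
    measurable_fun setT f -> measurable_fun setT k ->
    (forall s, 0 <= f s)%E -> (forall s, 0 <= k s)%E ->
    (forall s, c%:E <= f s + k s)%E ->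
  ((q * c)%:E <= \int[P1]_z f (h1 z) + \int[P2]_z k (h2 z))%E.

(** * Elementary rules for overlaps *)

Section overlap_theory.
Context {R : realType} {d1 d2 : measure_display}
  {T : measurableType d1} {S : measurableType d2}.
Implicit Types (P : {measure set T -> \bar R}) (h : T -> S).

Lemma overlapC P1 P2 h1 h2 (q : R) :
  overlap P1 P2 h1 h2 q -> overlap P2 P1 h2 h1 q.
Proof.
move=> H c f k c0 mf mk f0 k0 fk; rewrite addeC; apply: H => // s.
by rewrite addeC.
Qed.

Lemma overlap_le P1 P2 h1 h2 (p q : R) :
  p <= q -> overlap P1 P2 h1 h2 q -> overlap P1 P2 h1 h2 p.
Proof.
move=> pq H c f k c0 mf mk f0 k0 fk.
apply: le_trans (H c f k _ _ _ _ _ _) => //.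
by rewrite lee_fin ler_wpM2r.
Qed.

Lemma overlap0 P1 P2 h1 h2 : overlap P1 P2 h1 h2 (0 : R).
Proof.
move=> c f k c0 mf mk f0 k0 fk; rewrite mul0r.
by apply: adde_ge0; apply: integral_ge0.
Qed.

End overlap_theory.

(** * Tensorization over independent samples, and a Hahn criterion *)

Lemma integral_iidS {R : realType} {d : measure_display} {T : measurableType d}
    (P : probability T R) (n : nat) (F : n.+1.-tuple T -> \bar R) :
  measurable_fun setT F -> (forall t, 0 <= F t)%E ->
  (\int[iid P n.+1]_t F t =
   \int[P]_z \int[iid P n]_t F [tuple of z :: t])%E.
Proof.
move=> mF F0.
rewrite [LHS](ge0_integral_pushforward (@measurable_tuple_cons _ T n))//.
rewrite preimage_setT fubini_tonelli1//=.
by apply: measurableT_comp => //; exact: measurable_tuple_cons.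
Qed.

Lemma measurable_map_tuple {d1 d2 : measure_display} {T : measurableType d1}
    {S : measurableType d2} (h : T -> S) (n : nat) :
  measurable_fun setT h ->
  measurable_fun setT (fun t : n.-tuple T => map_tuple h t).
Proof.
move=> mh; apply/measurable_fun_tnthP => i.
rewrite (_ : _ \o _ = h \o (fun t : n.-tuple T => tnth t i)); last first.
  by apply/funext => t /=; rewrite tnth_map.
by apply: measurableT_comp => //; exact: measurable_tnth.
Qed.

(** Induction on the sample size. With the first observation [s] fixed, the induction hypothesis
    bounds the sum of the two inner integrals below by [q ^+ n * c]. As functions of [s] these
    integrals are thus a test pair for one draw, with the threshold [q ^+ n * c]. *)
Lemma overlap_iid {R : realType} {d1 d2 : measure_display}
    {T : measurableType d1} {S : measurableType d2}
    (P1 P2 : probability T R) (h1 h2 : T -> S) (q : R) (n : nat) :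
  measurable_fun setT h1 -> measurable_fun setT h2 -> 0 <= q ->
  overlap P1 P2 h1 h2 q ->
  overlap (iid P1 n) (iid P2 n) (fun t => map_tuple h1 t)
    (fun t => map_tuple h2 t) (q ^+ n).
Proof.
move=> mh1 mh2 q0 H; elim: n => [|n IH] c F K c0 mF mK F0 K0 FK.
  rewrite expr0 mul1r /= !integral_dirac//.
  - by rewrite !diracT !mul1e [map_tuple h1 _]tuple0 [map_tuple h2 _]tuple0.
  - by apply: measurableT_comp => //; exact: measurable_map_tuple.
  - by apply: measurableT_comp => //; exact: measurable_map_tuple.
have mcons h : measurable_fun setT h ->
    measurable_fun setT
      (fun z : S * n.-tuple T => [tuple of z.1 :: map_tuple h z.2]).
  move=> mh; apply: measurable_cons => //.
  apply: (measurableT_comp (@measurable_map_tuple _ _ _ _ h n mh)).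
  exact: measurable_snd.
have mapE h z (t : n.-tuple T) :
    map_tuple h [tuple of z :: t] = [tuple of h z :: map_tuple h t].
  exact/val_inj.
rewrite !integral_iidS//; last 2 first.
- by apply: measurableT_comp => //; exact: measurable_map_tuple.
- by apply: measurableT_comp => //; exact: measurable_map_tuple.
under eq_integral do under eq_integral do rewrite mapE.
under [X in (_ <= _ + X)%E]eq_integral do under eq_integral do rewrite mapE.
rewrite exprS -mulrA.
apply: (H (q ^+ n * c)
  (fun s => \int[iid P1 n]_t F [tuple of s :: map_tuple h1 t])%E
  (fun s => \int[iid P2 n]_t K [tuple of s :: map_tuple h2 t])%E).
- by rewrite mulr_ge0// exprn_ge0.
- apply: (measurable_fun_fubini_tonelli_F
    (fun z => F [tuple of z.1 :: map_tuple h1 z.2])) => //.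
  by apply: measurableT_comp => //; exact: mcons.
- apply: (measurable_fun_fubini_tonelli_F
    (fun z => K [tuple of z.1 :: map_tuple h2 z.2])) => //.
  by apply: measurableT_comp => //; exact: mcons.
- by move=> s; exact: integral_ge0.
- by move=> s; exact: integral_ge0.
- have mcs s : measurable_fun setT (fun t : n.-tuple S => [tuple of s :: t]).
    exact: measurable_cons.
  move=> s; apply: (IH c (fun t => F [tuple of s :: t])
    (fun t => K [tuple of s :: t])) => //.
  + exact: (measurableT_comp mF).
  + exact: (measurableT_comp mK).
Qed.

Lemma overlap_Hahn {R : realType} {d : measure_display} {T : measurableType d}
    (P1 P2 : probability T R) (U : set T) (q : R) :
  measurable U ->
  (forall V, measurable V -> V `<=` U -> P2 V <= P1 V)%E ->
  (forall V, measurable V -> V `<=` ~` U -> P1 V <= P2 V)%E ->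
  (q%:E <= P2 U + P1 (~` U))%E ->
  overlap P1 P2 idfun idfun q.
Proof.
move=> mU le21 le12 qU c f k c0 mf mk f0 k0 fk.
have mCU : measurable (~` U) by exact: measurableC.
(* The measures are compared only on subsets of [V], so both are replaced by their restrictions to
   [V], which are ordered everywhere. *)
have le_restr (m1 m2 : {measure set T -> \bar R}) (V : set T)
    (g : T -> \bar R) (mV : measurable V) :
    measurable_fun setT g -> (forall x, 0 <= g x)%E ->
    (forall W, measurable W -> W `<=` V -> m1 W <= m2 W)%E ->
    (\int[m1]_(x in V) g x <= \int[m2]_(x in V) g x)%E.
  move=> mg g0 m12.
  rewrite (@eq_measure_integral _ _ _ _ (mrestr m1 mV) m1); last first.
    by move=> W mW WV; rewrite /= /mrestr setIidl.
  rewrite (@eq_measure_integral _ _ _ _ (mrestr m2 mV) m2); last first.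
    by move=> W mW WV; rewrite /= /mrestr setIidl.
  apply: ge0_le_measure_integral => // W mW.
  by rewrite /mrestr; apply: m12; [exact: measurableI|exact: subIsetr].
have split (m : {measure set T -> \bar R}) (g : T -> \bar R) :
    measurable_fun setT g -> (forall x, 0 <= g x)%E ->
    (\int[m]_x g x = \int[m]_(x in U) g x + \int[m]_(x in ~` U) g x)%E.
  move=> mg g0; rewrite -(setUv U) ge0_integral_setU//.
  - by rewrite setUv.
  - by apply/disj_set2P; rewrite setICr.
have sum (m : {measure set T -> \bar R}) V : measurable V ->
    (c%:E * m V <= \int[m]_(x in V) f x + \int[m]_(x in V) k x)%E.
  move=> mV; rewrite -ge0_integralD//; last 2 first.
  - exact: measurable_funTS.
  - exact: measurable_funTS.
  rewrite -integral_cst//; apply: ge0_le_integral => //.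
  - by apply: emeasurable_funD; exact: measurable_funTS.
apply: (@le_trans _ _ (c%:E * P2 U + c%:E * P1 (~` U))%E).
  rewrite -ge0_muleDr// mulrC EFinM.
  by apply: lee_wpmul2l => //; rewrite lee_fin.
rewrite (split P1 f)// (split P2 k)//.
rewrite (_ : _ + _ = (\int[P1]_(x in U) f x + \int[P2]_(x in U) k x) +
   (\int[P1]_(x in ~` U) f x + \int[P2]_(x in ~` U) k x))%E; last first.
  by rewrite addeACA.
apply: leeD.
  by apply: le_trans (sum P2 U mU) _; apply: leeD => //; exact: le_restr.
by apply: le_trans (sum P1 _ mCU) _; apply: leeD => //; exact: le_restr.
Qed.

(** * Overlap of two translates of a Gaussian *)

Section gaussian_shift.
Context {R : realType}.
Local Notation mu := (@lebesgue_measure R).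
Implicit Types (a b s : R).

Let measurable_shiftR a :
  measurable_fun setT (fun x : measurableTypeR R => (a + x : measurableTypeR R)).
Proof. by apply: measurable_funD. Qed.

Lemma lebesgue_measure_shift a (V : set (measurableTypeR R)) : measurable V ->
  pushforward mu (fun x : measurableTypeR R => (a + x : measurableTypeR R)) V =
  mu V.
Proof.
move=> mV; apply/esym.
apply: (@lebesgue_measure_unique R (pushforward mu
  (fun x : measurableTypeR R => (a + x : measurableTypeR R)))) => //.
move=> _ [[l r]] _ <-; rewrite /= /pushforward.
rewrite (_ : _ @^-1` _ = `]l - a, r - a]%classic); last first.
  apply/seteqP; split => x /=; rewrite !in_itv/= => /andP[lx xr];
    by apply/andP; split; lra.
rewrite !lebesgue_measure_itv/= !lte_fin ltrD2r; case: ifP => // _.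
by rewrite -!EFinB; congr EFin; lra.
Qed.

Lemma normal_prob_shift a s (V : set (measurableTypeR R)) : s != 0 ->
  measurable V ->
  normal_prob 0 s ((fun x : measurableTypeR R => (a + x : measurableTypeR R))
    @^-1` V) = normal_prob a s V.
Proof.
move=> s0 mV; rewrite /normal_prob.
rewrite [RHS](@eq_measure_integral _ _ _ _ (pushforward mu
    (fun x : measurableTypeR R => (a + x : measurableTypeR R))) mu); last first.
  by move=> W mW _; rewrite [RHS]lebesgue_measure_shift.
rewrite [RHS](ge0_integral_pushforward (measurable_shiftR a) mu mV).
- apply: eq_integral => x _ /=; rewrite !normal_pdfE//.
  by rewrite /normal_fun subr0 (addrC a) addrK.
- apply/measurable_funTS/measurable_EFinP; exact: measurable_normal_pdf.
- by move=> y _; rewrite lee_fin normal_pdf_ge0.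
Qed.

(** The peak is the inverse of the square root of [2 * pi * s ^+ 2], and [2 * pi >= 1]; the cruder
    bound keeps [pi] out of the later constants. *)
Lemma normal_peak_le s : 0 < s -> normal_peak s <= s^-1.
Proof.
move=> s0; rewrite /normal_peak lef_pV2 ?posrE//; last first.
  by rewrite sqrtr_gt0 mulrn_wgt0// mulr_gt0 ?pi_gt0// exprn_gt0.
rewrite -[leLHS](gtr0_norm s0) -sqrtr_sqr ler_wsqrtr//.
have := pi_ge2 R; rewrite -mulrnAr => pi2.
by rewrite ler_peMr ?sqr_ge0// mulr2n; lra.
Qed.

Lemma normal_prob_itv_le a b s : 0 < s -> a <= b ->
  (normal_prob 0 s `[a, b[ <= ((b - a) / s)%:E)%E.
Proof.
move=> s0 ab; rewrite /normal_prob.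
apply: (@le_trans _ _ (\int[mu]_(x in `[a, b[) (s^-1)%:E)%E).
  apply: ge0_le_integral => //.
  - by move=> x _; rewrite lee_fin normal_pdf_ge0.
  - by apply/measurable_funTS/measurable_EFinP; exact: measurable_normal_pdf.
  - move=> x _; rewrite lee_fin (le_trans _ (normal_peak_le s s0))//.
    by rewrite normal_pdf_ub// gt_eqF.
rewrite integral_cst// [X in (_ * X)%E]lebesgue_measure_itv/= lte_fin.
case: ifP => _.
  by rewrite -EFinB -EFinM mulrC.
by rewrite mule0 lee_fin divr_ge0 ?subr_ge0// ltW.
Qed.

Lemma normal_pdf_le a b s (x : R) : s != 0 ->
  (x - a) ^+ 2 <= (x - b) ^+ 2 -> normal_pdf b s x <= normal_pdf a s x.
Proof.
move=> s0 ab; rewrite !normal_pdfE// ler_wpM2l ?normal_peak_ge0//.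
rewrite /normal_fun ler_expR ler_wpM2r//; last by rewrite lerN2.
by rewrite invr_ge0 mulrn_wge0// sqr_ge0.
Qed.

Lemma normal_prob_le a b s (V : set (measurableTypeR R)) : s != 0 ->
  measurable V -> (forall x, V x -> (x - a) ^+ 2 <= (x - b) ^+ 2) ->
  (normal_prob b s V <= normal_prob a s V)%E.
Proof.
move=> s0 mV Vab; rewrite /normal_prob; apply: ge0_le_integral => //.
- by move=> x _; rewrite lee_fin normal_pdf_ge0.
- by apply/measurable_funTS/measurable_EFinP; exact: measurable_normal_pdf.
- by apply/measurable_funTS/measurable_EFinP; exact: measurable_normal_pdf.
- by move=> x Vx; rewrite lee_fin; apply: normal_pdf_le => //; exact: Vab.
Qed.

(** The two densities cross at the midpoint of the centres, so the half-line to its left is a Hahn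
    set. After recentring, the mass missing from the overlap is that of an interval of length
    [b - a] under a density bounded by [s^-1]. *)
Lemma overlap_normal_prob_le a b s : 0 < s -> a <= b ->
  @overlap R _ _ (measurableTypeR R) (measurableTypeR R)
    (normal_prob a s) (normal_prob b s) idfun idfun (1 - (b - a) / s).
Proof.
move=> s0 ab; have sn0 : s != 0 by rewrite gt_eqF.
pose U : set (measurableTypeR R) := `]-oo, ((a + b) / 2)[%classic.
have mU : measurable U by exact: measurable_itv.
pose Pa : probability (measurableTypeR R) R := normal_prob a s.
pose Pb : probability (measurableTypeR R) R := normal_prob b s.
have PaE V : Pa V = normal_prob a s V by [].
have PbE V : Pb V = normal_prob b s V by [].
apply: (@overlap_Hahn R _ (measurableTypeR R) Pa Pb U).
- exact: mU.
- move=> V mV VU; rewrite PaE PbE; apply: normal_prob_le => // x /VU.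
  by rewrite /U/= in_itv/= => xm; nra.
- move=> V mV VU; rewrite PaE PbE; apply: normal_prob_le => // x /VU.
  by rewrite /U/= in_itv/= => /negP; rewrite -leNgt => xm; nra.
- rewrite PaE PbE -(normal_prob_shift a)//; last exact: measurableC.
  rewrite -(normal_prob_shift b)//.
  set A := (X in (_ <= normal_prob 0 s X + _)%E).
  set B := (X in (_ <= _ + normal_prob 0 s X)%E).
  have mA : measurable A.
    by rewrite /A -[X in measurable X]setTI; exact: measurable_shiftR.
  have mB : measurable B.
    rewrite /B -[X in measurable X]setTI; apply: measurable_shiftR => //.
    exact: measurableC.
  (* The two tails, each recentred at 0, leave out exactly the interval of length [b - a] around
     0. *)
  have AB : A `|` B = ~` `[(a - b) / 2, (b - a) / 2[%classic.
    apply/seteqP; split => x; rewrite /A /B /U /= !in_itv/=.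
      move=> [xm|/negP].
        by apply/negP; rewrite negb_and -ltNge; apply/orP; left; lra.
      rewrite -leNgt => xm.
      by apply/negP; rewrite negb_and -leNgt; apply/orP; right; lra.
    move=> /negP; rewrite negb_and -ltNge -leNgt => /orP[xm|xm].
      by left; lra.
    by right; apply/negP; rewrite -leNgt; lra.
  have AB0 : A `&` B = set0.
    apply/seteqP; split => // x; rewrite /A /B /U /= !in_itv/= => -[xm] /negP.
    by rewrite -leNgt; lra.
  pose P0 : probability (measurableTypeR R) R := normal_prob 0 s.
  pose I : set (measurableTypeR R) := `[(a - b) / 2, (b - a) / 2[%classic.
  have mI : measurable I by exact: measurable_itv.
  have := measureU P0 mA mB AB0; rewrite AB => P0AB.
  have -> : (normal_prob 0 s A + normal_prob 0 s B = 1 - normal_prob 0 s I)%E.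
    exact: etrans (esym P0AB) (probability_setC P0 mI).
  rewrite EFinB leeB//.
  have -> : b - a = (b - a) / 2 - (a - b) / 2 by lra.
  by apply: normal_prob_itv_le => //; lra.
Qed.

Lemma overlap_normal_prob a b s : 0 < s ->
  @overlap R _ _ (measurableTypeR R) (measurableTypeR R)
    (normal_prob a s) (normal_prob b s) idfun idfun (1 - `|a - b| / s).
Proof.
move=> s0; have [ab|/ltW ba] := leP a b.
  by rewrite distrC ger0_norm ?subr_ge0//; exact: overlap_normal_prob_le.
by rewrite ger0_norm ?subr_ge0//; apply: overlapC; exact: overlap_normal_prob_le.
Qed.

Lemma integral_centered_normal_shift a s (f : R -> \bar R) : 0 < s ->
  measurable_fun setT f -> (forall x, 0 <= f x)%E ->
  (\int[centered_normal s]_e f (a + e)%R = \int[normal_prob a s]_x f x)%E.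
Proof.
move=> s0 mf f0; have sn0 : s != 0 by rewrite gt_eqF.
rewrite /centered_normal (negbTE sn0).
have mfa : measurable_fun setT (fun e : R => f (a + e)).
  by apply: measurableT_comp => //; exact: measurable_funD.
pose N0 : probability (measurableTypeR R) R := normal_prob 0 s.
have fa0 : {in [set: R], forall e, (0 <= f (a + e)%R)%E} by [].
have ft0 : {in [set: measurableTypeR R], forall x, (0 <= f x)%E} by [].
(* Two changes of variables: the first removes the display change [realR], the second the
   translation by [a]. *)
have := ge0_integral_pushforward (@measurable_realR R) N0 measurableT mfa fa0.
rewrite preimage_setT => h1; apply: (etrans h1) => {h1}.
have := ge0_integral_pushforward (measurable_shiftR a) N0 measurableT mf ft0.
rewrite preimage_setT => h2; apply: (etrans (esym h2)) => {h2}.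
by apply: eq_measure_integral => W mW _; exact: normal_prob_shift.
Qed.

Lemma overlap_centered_normal a b s : 0 < s ->
  overlap (centered_normal s) (centered_normal s) (fun e => a + e)
    (fun e => b + e) (1 - `|a - b| / s).
Proof.
move=> s0 c f k c0 mf mk f0 k0 fk.
rewrite !integral_centered_normal_shift//.
exact: (overlap_normal_prob a b s s0).
Qed.

End gaussian_shift.

(** * Equal mixtures of two laws *)

Section mixture.
Context {R : realType} {d : measure_display} {T : measurableType d}.
Variables P Q : probability T R.

Let half_ge0 : 0 <= 2^-1 :> R. Proof. by rewrite invr_ge0. Qed.
Let half := NngNum half_ge0.

Definition mixture : set T -> \bar R :=
  measure_add (mscale half P) (mscale half Q).

HB.instance Definition _ := Measure.on mixture.

Lemma mixtureE (A : set T) : (mixture A = 2^-1%:E * P A + 2^-1%:E * Q A)%E.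
Proof. by rewrite /mixture measure_addE. Qed.

Let mixtureT : mixture setT = 1%E.
Proof.
rewrite mixtureE !probability_setT !mule1 -EFinD; congr EFin; lra.
Qed.

HB.instance Definition _ := Measure_isProbability.Build _ _ _ mixture mixtureT.

Lemma integral_mixture (f : T -> \bar R) :
  measurable_fun setT f -> (forall x, 0 <= f x)%E ->
  (\int[mixture]_x f x =
   2^-1%:E * \int[P]_x f x + 2^-1%:E * \int[Q]_x f x)%E.
Proof.
move=> mf f0; rewrite /mixture ge0_integral_measure_add//.
by rewrite !ge0_integral_mscale.
Qed.

End mixture.

(** * Oblivious plus Gaussian noise at a fixed covariate *)

Section noise.
Context {R : realType}.
Variable sigma : R.
Implicit Types (mu nu : probability R R) (a b q s t : R).
Local Notation N := (centered_normal sigma).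

(** Here [a] and [b] stand for [g (dotp u x)] and [g (dotp v x)] at a fixed [x]; [mu] and [nu] are
    the oblivious noise laws under the two hypotheses. *)
Definition noise_overlap mu nu a b q :=
  overlap (mu \x N)%E (nu \x N)%E (fun z : R * R => a + z.1 + z.2)
    (fun z : R * R => b + z.1 + z.2) q.

Lemma measurable_shift2 a : measurable_fun setT (fun z : R * R => a + z.1 + z.2).
Proof. by apply: measurable_funD => //; apply: measurable_funD. Qed.

Let measurable_inner a (f : R -> \bar R) : measurable_fun setT f ->
  (forall x, 0 <= f x)%E ->
  measurable_fun setT (fun x : R => \int[N]_e f (a + x + e)%R)%E.
Proof.
move=> mf f0; apply: (measurable_fun_fubini_tonelli_F
  (fun z : R * R => f (a + z.1 + z.2))) => //.
by apply: measurableT_comp => //; exact: measurable_shift2.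
Qed.

Let integral_noise mu a (f : R -> \bar R) : measurable_fun setT f ->
  (forall x, 0 <= f x)%E ->
  (\int[mu \x N]_z f (a + z.1 + z.2)%R =
   \int[mu]_x \int[N]_e f (a + x + e)%R)%E.
Proof.
move=> mf f0; rewrite fubini_tonelli1//.
by apply: measurableT_comp => //; exact: measurable_shift2.
Qed.

(** Both integrals are linear in the noise law, so pairing [mu1] with [nu1] and [mu2] with [nu2]
    averages the two bounds for the same test pair. *)
Lemma noise_overlap_mixture mu1 mu2 nu1 nu2 a b q1 q2 :
  noise_overlap mu1 nu1 a b q1 -> noise_overlap mu2 nu2 a b q2 ->
  noise_overlap (mixture mu1 mu2) (mixture nu1 nu2) a b ((q1 + q2) / 2).
Proof.
move=> H1 H2 c f k c0 mf mk f0 k0 fk.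
have := H1 c f k c0 mf mk f0 k0 fk; have := H2 c f k c0 mf mk f0 k0 fk.
rewrite !integral_noise// !integral_mixture//; last 4 first.
- exact: measurable_inner.
- by move=> x; exact: integral_ge0.
- exact: measurable_inner.
- by move=> x; exact: integral_ge0.
set F1 := (\int[mu1]_x _)%E; set F2 := (\int[mu2]_x _)%E.
set K1 := (\int[nu1]_x _)%E; set K2 := (\int[nu2]_x _)%E => h2 h1.
have ? : (0 <= F1)%E by do 2 (apply: integral_ge0 => ? _).
have ? : (0 <= F2)%E by do 2 (apply: integral_ge0 => ? _).
have ? : (0 <= K1)%E by do 2 (apply: integral_ge0 => ? _).
have ? : (0 <= K2)%E by do 2 (apply: integral_ge0 => ? _).
rewrite addeACA -!ge0_muleDr//.
- rewrite (_ : _ * c = 2^-1 * (q1 * c + q2 * c)); last by lra.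
  by rewrite EFinM EFinD; apply: lee_wpmul2l => //; exact: leeD.
- exact: adde_ge0.
- exact: adde_ge0.
Qed.

Lemma noise_overlap_dirac s t a b : 0 < sigma ->
  noise_overlap (\d_s : probability R R) (\d_t : probability R R) a b
    (1 - `|a + s - (b + t)| / sigma).
Proof.
move=> s0 c f k c0 mf mk f0 k0 fk.
rewrite !integral_noise// !integral_dirac//; last 2 first.
- exact: measurable_inner.
- exact: measurable_inner.
rewrite !diracT !mul1e.
exact: overlap_centered_normal.
Qed.

(** The oblivious noise alone hides the shift, whatever [sigma] is: integrate over it first, at a
    fixed value [e] of the other noise, where the translates of [f] and [k] by [e] still form a test
    pair. *)
Lemma noise_overlap_normal s a b : 0 < s ->
  noise_overlap (centered_normal s) (centered_normal s) a b
    (1 - `|a - b| / s).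
Proof.
move=> s0 c f k c0 mf mk f0 k0 fk.
have mr (e : R) (h : R -> \bar R) : measurable_fun setT h ->
  measurable_fun setT (fun x : R => h (x + e)).
  by move=> mh; apply: measurableT_comp => //; exact: measurable_funD.
have swap a' (h : R -> \bar R) : measurable_fun setT h ->
    (forall x, 0 <= h x)%E ->
    (\int[centered_normal s \x N]_z h (a' + z.1 + z.2)%R =
     \int[N]_e \int[centered_normal s]_x h (a' + x + e)%R)%E.
  move=> mh h0; rewrite fubini_tonelli2//.
  by apply: measurableT_comp => //; exact: measurable_shift2.
have minner a' (h : R -> \bar R) : measurable_fun setT h ->
    (forall x, 0 <= h x)%E ->
    measurable_fun setT (fun e : R => \int[centered_normal s]_x h (a' + x + e)%R)%E.
  move=> mh h0; apply: (measurable_fun_fubini_tonelli_G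
    (fun z : R * R => h (a' + z.1 + z.2))) => //.
  by apply: measurableT_comp => //; exact: measurable_shift2.
rewrite !swap// -ge0_integralD//; last 4 first.
- by move=> e _; exact: integral_ge0.
- exact: minner.
- by move=> e _; exact: integral_ge0.
- exact: minner.
(* Monotonicity of the integral is applied to nonnegative functions, so a nonpositive lower bound is
   dealt with apart. *)
have [qc0|qc0] := leP ((1 - `|a - b| / s) * c) 0.
  apply: (@le_trans _ _ 0%E); first by rewrite lee_fin.
  by apply: integral_ge0 => e _; apply: adde_ge0; exact: integral_ge0.
rewrite -[leLHS]mule1 -(@probability_setT _ _ _ N) -integral_cst//.
apply: ge0_le_integral => //.
- by move=> e _; rewrite lee_fin ltW.
- by apply: emeasurable_funD; exact: minner.
- move=> e _; apply: (overlap_centered_normal a b s s0 c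
    (fun x : R => f (x + e)) (fun x : R => k (x + e))) => //; exact: mr.
Qed.

End noise.

(** * Overlap of one GLM draw, and its consequence for algorithms *)

Section glm_overlap.
Context {R : realType} {d : nat}.
Implicit Types (w u v x : d.-tuple R) (g : R -> R).

Lemma measurable_dotp w : measurable_fun setT (@dotp R d w).
Proof.
apply: measurable_sum => i; apply: measurable_funM => //.
exact: measurable_tnth.
Qed.

Lemma measurable_glm g w : {homo g : s t / s <= t} ->
  measurable_fun setT (fun x => g (dotp w x)).
Proof.
move=> g_homo; apply: measurableT_comp; last exact: measurable_dotp.
exact: nondecreasing_measurable.
Qed.

Lemma measurable_glm_draw g w : {homo g : s t / s <= t} ->
  measurable_fun setT (@glm_draw R d g w).
Proof.
move=> g_homo.
rewrite (_ : glm_draw g w = fun z => (z.1.1, g (dotp w z.1.1) + z.1.2 + z.2));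
  last by apply/funext => -[[]].
have m11 : measurable_fun setT (fun z : d.-tuple R * R * R => z.1.1).
  by apply: measurableT_comp.
apply/measurable_fun_pair => //; apply: measurable_funD => //.
apply: measurable_funD; last by apply: measurableT_comp.
exact: (measurableT_comp (measurable_glm g w g_homo)).
Qed.

Lemma integral_glm_draw (D : probability (d.-tuple R) R)
    (Xi N : probability R R) g w (f : d.-tuple R * R -> \bar R) :
  {homo g : s t / s <= t} -> measurable_fun setT f -> (forall z, 0 <= f z)%E ->
  (\int[(D \x Xi) \x N]_z f (glm_draw g w z) =
   \int[D]_x \int[Xi \x N]_e f (x, g (dotp w x) + e.1 + e.2)%R)%E.
Proof.
move=> g_homo mf f0.
have mfd : measurable_fun setT (fun z => f (glm_draw g w z)).
  by apply: measurableT_comp => //; exact: measurable_glm_draw.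
pose DXi : probability (d.-tuple R * R)%type R := (D \x Xi)%E.
have fd0 z : (0 <= f (glm_draw g w z))%E by [].
apply: (etrans (@fubini_tonelli1 _ _ _ _ R DXi N _ mfd fd0)).
have mF := @measurable_fun_fubini_tonelli_F _ _ _ _ R N _ mfd fd0.
have F0 z : (0 <= fubini_F N (fun z => f (glm_draw g w z)) z)%E.
  exact: integral_ge0.
apply: (etrans (@fubini_tonelli1 _ _ _ _ R D Xi _ mF F0)).
apply: eq_integral => x _; rewrite fubini_tonelli1//.
apply: measurableT_comp => //; apply/measurable_fun_pair => //.
exact: measurable_shift2.
Qed.

Lemma measurable_glm_noise (Xi N : probability R R) g w
    (f : d.-tuple R * R -> \bar R) :
  {homo g : s t / s <= t} -> measurable_fun setT f -> (forall z, 0 <= f z)%E ->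
  measurable_fun setT
    (fun x => \int[Xi \x N]_e f (x, g (dotp w x) + e.1 + e.2)%R)%E.
Proof.
move=> g_homo mf f0.
pose XiN : probability (R * R)%type R := (Xi \x N)%E.
apply: (@measurable_fun_fubini_tonelli_F _ _ (d.-tuple R) _ R XiN
  (fun z => f (z.1, g (dotp w z.1) + z.2.1 + z.2.2))) => //.
apply: measurableT_comp => //; apply/measurable_fun_pair => //.
apply: measurable_funD; last by apply: measurableT_comp.
apply: measurable_funD; last by apply: measurableT_comp.
exact: (measurableT_comp (measurable_glm g w g_homo)).
Qed.

(** The covariate has the same law under both hypotheses, so one can condition on it; the part of
    the integral outside [G] is nonnegative and is dropped. *)
Lemma overlap_glm_draw (D : probability (d.-tuple R) R) (Xi1 Xi2 : probability R R)
    (sigma : R) g u v (G : set (d.-tuple R)) (p q : R) :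
  {homo g : s t / s <= t} -> measurable G -> (p%:E <= D G)%E -> 0 <= q ->
  (forall x, G x ->
    noise_overlap sigma Xi1 Xi2 (g (dotp u x)) (g (dotp v x)) q) ->
  overlap ((D \x Xi1) \x centered_normal sigma)%E
    ((D \x Xi2) \x centered_normal sigma)%E
    (glm_draw g u) (glm_draw g v) (p * q).
Proof.
move=> g_homo mG pG q0 H c f k c0 mf mk f0 k0 fk.
have m1 := measurable_glm_noise Xi1 (centered_normal sigma) g u f g_homo mf f0.
have m2 := measurable_glm_noise Xi2 (centered_normal sigma) g v k g_homo mk k0.
rewrite !integral_glm_draw// -ge0_integralD//; last 2 first.
- by move=> x _; exact: integral_ge0.
- by move=> x _; exact: integral_ge0.
apply: (@le_trans _ _ (\int[D]_(x in G) (q * c)%:E)%E).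
  rewrite integral_cst// (_ : p * q * c = q * c * p); last by lra.
  by rewrite EFinM; apply: lee_wpmul2l => //; rewrite lee_fin mulr_ge0.
have msum : measurable_fun setT (fun x =>
  \int[Xi1 \x centered_normal sigma]_e f (x, g (dotp u x) + e.1 + e.2)%R +
  \int[Xi2 \x centered_normal sigma]_e k (x, g (dotp v x) + e.1 + e.2)%R)%E.
  exact: emeasurable_funD.
apply: (le_trans _ (ge0_subset_integral _ _ _ _ _ (@subsetT _ G))) => //; last first.
  by move=> x _; apply: adde_ge0; exact: integral_ge0.
apply: ge0_le_integral => //.
- by move=> x _; rewrite lee_fin mulr_ge0.
- exact: measurable_funTS.
- move=> x Gx; apply: (H x Gx c (fun y => f (x, y)) (fun y => k (x, y))) => //.
  + by apply: measurableT_comp => //; exact: measurable_pair1.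
  + by apply: measurableT_comp => //; exact: measurable_pair1.
Qed.

(** Each coordinate of a point of the unit ball is at most 1 in absolute value. What matters is that
    the bound does not depend on [x]. *)
Lemma dotp_le w x : l2norm x <= 1 -> `|dotp w x| <= \sum_(i < d) `|tnth w i|.
Proof.
move=> x1; apply: le_trans (ler_norm_sum _ _ _) _; apply: ler_sum => i _.
rewrite normrM ler_piMr//; apply: le_trans x1.
rewrite -sqrtr_sqr ler_wsqrtr// (bigD1 i)//= lerDl.
by apply: sumr_ge0 => j _; exact: sqr_ge0.
Qed.

Lemma measurable_l2norm : measurable_fun setT (@l2norm R d).
Proof.
apply: (@measurableT_comp _ _ _ _ _ _ (@Num.sqrt R)).
  by apply: nondecreasing_measurable => // s t; exact: ler_wsqrtr.
apply: measurable_sum => i; apply: measurable_funX.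
exact: measurable_tnth.
Qed.

(** The test pair is the probability of answering [false] and that of answering [true], which sum to
    1. Integrated under [u] and [v] respectively they are the two error probabilities, each at most
    [delta]. Success for every admissible noise allows [Xi1] and [Xi2] to differ. *)
Lemma distinguishes_overlap (D : probability (d.-tuple R) R) (sigma alpha : R) g
    u v (delta q : R) (m : nat) (alg : @algorithm R d m)
    (Xi1 Xi2 : probability R R) :
  {homo g : s t / s <= t} -> 0 <= q ->
  (alpha%:E <= Xi1 [set 0%R])%E -> (alpha%:E <= Xi2 [set 0%R])%E ->
  overlap ((D \x Xi1) \x centered_normal sigma)%E
    ((D \x Xi2) \x centered_normal sigma)%E
    (glm_draw g u) (glm_draw g v) q ->
  distinguishes D g sigma alpha u v delta alg -> q ^+ m <= 2 * delta.
Proof.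
move=> g_homo q0 Xi10 Xi20 ov dist.
have [hu _] := dist Xi1 Xi10; have [_ hv] := dist Xi2 Xi20.
have mu := measurable_glm_draw g u g_homo.
have mv := measurable_glm_draw g v g_homo.
have malg b : measurable_fun setT (fun t => alg t [set b]).
  exact: measurable_kernel.
have algE t : (alg t [set true] + alg t [set false] = 1)%E.
  rewrite -measureU//; last by apply/seteqP; split => // x [/= ->].
  have -> : [set true] `|` [set false] = setT.
    by apply/seteqP; split => // -[] _ /=; tauto.
  exact: prob_kernel.
have total (Xi : probability R R) w : measurable_fun setT (glm_draw g w) ->
    (answer_prob D Xi sigma g w alg true +
     answer_prob D Xi sigma g w alg false = 1)%E.
  move=> mw; rewrite /answer_prob -ge0_integralD//; last 2 first.
  - exact: (measurableT_comp (malg _) (measurable_map_tuple _ m mw)).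
  - exact: (measurableT_comp (malg _) (measurable_map_tuple _ m mw)).
  under eq_integral do rewrite algE.
  by rewrite integral_cst// mul1e; exact: probability_setT.
have le_delta (x y : \bar R) : (0 <= x)%E -> (0 <= y)%E -> (x + y = 1)%E ->
    ((1 - delta)%:E <= x)%E -> (y <= delta%:E)%E.
  move: x y => [x| |] [y| |]//= x0 y0; rewrite -EFinD => -[xy].
  by rewrite !lee_fin; lra.
have ans_ge0 (Xi : probability R R) w b :
    (0 <= answer_prob D Xi sigma g w alg b)%E by exact: integral_ge0.
have uF := le_delta _ _ (ans_ge0 _ _ _) (ans_ge0 _ _ _) (total Xi1 u mu) hu.
have vT : (answer_prob D Xi2 sigma g v alg true <= delta%:E)%E.
  exact: (le_delta _ _ (ans_ge0 _ _ _) (ans_ge0 _ _ _)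
    (etrans (addeC _ _) (total Xi2 v mv)) hv).
have := overlap_iid _ _ _ _ _ m mu mv q0 ov 1 (fun t => alg t [set false])
  (fun t => alg t [set true]) ler01 (malg _) (malg _).
rewrite mulr1 -lee_fin (_ : 2 * delta = delta + delta); last by lra.
move=> H; apply: (le_trans (H _ _ _)) => // [t|].
  by rewrite addeC algE.
by rewrite EFinD; exact: (leeD uF vT).
Qed.

End glm_overlap.

(** * The two noise constructions and the resulting sample bounds *)

Section sample_bounds.
Context {R : realType} {d : nat}.
Implicit Types (u v : d.-tuple R) (g : R -> R).

(** Admissibility of the constructed noises: a point mass at 0 of weight one half is where
    [alpha <= 2^-1] enters. *)
Let mixture_atom (P Q : probability R R) (alpha : R) : alpha <= 2^-1 ->
  P [set 0%R] = 1%E -> (alpha%:E <= mixture P Q [set 0%R])%E.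
Proof.
move=> alpha2 P0; rewrite mixtureE P0 mule1.
by apply: le_trans (leeDl _ _); rewrite ?lee_fin// mule_ge0// lee_fin invr_ge0.
Qed.

Let mixtureC_atom (P Q : probability R R) (alpha : R) : alpha <= 2^-1 ->
  Q [set 0%R] = 1%E -> (alpha%:E <= mixture P Q [set 0%R])%E.
Proof.
move=> alpha2 Q0; have := mixture_atom Q P alpha alpha2 Q0.
by rewrite !mixtureE addeC.
Qed.

Let dirac00 : (\d_(0 : R) : probability R R) [set 0%R] = 1%E.
Proof. by rewrite /= diracE mem_set. Qed.

(* The oblivious noises are uniform on {0, -A} under u and on {A, 0} under v, so
   that g (u . x) + xi and g (v . x) + xi can be coupled at distance at most tau
   with probability 1 - tau. *)
Lemma distinguishes_gap (D : probability (d.-tuple R) R) (sigma tau alpha A : R)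
    g u v (delta : R) (m : nat) (alg : @algorithm R d m) :
  {homo g : s t / s <= t} -> 0 < sigma -> 0 <= tau <= sigma ->
  tau <= 1 -> alpha <= 2^-1 -> (gap_prob D g tau u v A <= tau%:E)%E ->
  distinguishes D g sigma alpha u v delta alg ->
  ((1 - tau) * (1 - tau / sigma)) ^+ m <= 2 * delta.
Proof.
move=> g_homo sigma0 /andP[tau0 tau_sigma] tau1 alpha2 gap.
have q0 : 0 <= 1 - tau / sigma by rewrite subr_ge0 ler_pdivrMr// mul1r.
pose d0 : probability R R := \d_(0 : R).
pose dA : probability R R := \d_A.
pose dNA : probability R R := \d_(- A).
pose G := [set x : d.-tuple R | `|g (dotp u x) - g (dotp v x) - A| > tau].
have mG : measurable G.
  rewrite (_ : G = (fun x => `|g (dotp u x) - g (dotp v x) - A|)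
      @^-1` `]tau, +oo[%classic); last first.
    by apply/seteqP; split => x /=; rewrite in_itv/= andbT.
  rewrite -[X in measurable X]setTI.
  have mabs : measurable_fun setT
      (fun x : d.-tuple R => `|g (dotp u x) - g (dotp v x) - A|).
    apply: measurableT_comp => //; apply: measurable_funB => //.
    by apply: measurable_funB; exact: measurable_glm.
  by apply: mabs => //; exact: measurable_itv.
apply: (@distinguishes_overlap R d D sigma alpha g u v delta _ m alg
  (mixture d0 dNA) (mixture dA d0)) => //.
- by rewrite mulr_ge0// subr_ge0.
- exact: mixture_atom.
- exact: mixtureC_atom.
apply: (@overlap_glm_draw R d D _ _ sigma g u v (~` G)) => //.
- exact: measurableC.
- by rewrite probability_setC// EFinB leeB.
move=> x /negP; rewrite -leNgt => xG.
rewrite [1 - _](_ : _ = ((1 - tau / sigma) + (1 - tau / sigma)) / 2); last by lra.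
(* The value 0 under [u] is paired with [A] under [v], and [- A] with 0; either way the centres
   differ by [g (dotp u x) - g (dotp v x) - A]. *)
apply: noise_overlap_mixture.
- apply: overlap_le (noise_overlap_dirac sigma 0 A _ _ sigma0).
  by rewrite lerD2l lerN2 ler_pM2r ?invr_gt0// addr0 opprD addrA.
- apply: overlap_le (noise_overlap_dirac sigma (- A) 0 _ _ sigma0).
  by rewrite lerD2l lerN2 ler_pM2r ?invr_gt0// addr0 addrAC.
Qed.

(* Half of the oblivious noise is a Gaussian so wide that it hides the bounded
   quantity g (w . x). *)
Lemma distinguishes_bounded (D : probability (d.-tuple R) R) (sigma alpha : R)
    g u v (delta : R) (m : nat) (alg : @algorithm R d m) :
  {homo g : s t / s <= t} -> alpha <= 2^-1 -> supported_in_unit_ball D ->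
  distinguishes D g sigma alpha u v delta alg ->
  (4^-1) ^+ m <= 2 * delta.
Proof.
move=> g_homo alpha2 Dball.
(* On the unit ball both inner products lie in [[- B, B]], so by monotonicity both values of [g] lie
   in an interval of length [C]. *)
pose B := \sum_(i < d) `|tnth u i| + \sum_(i < d) `|tnth v i|.
pose C := g B - g (- B).
have C0 : 0 <= C.
  rewrite subr_ge0 g_homo// ge0_cp//.
  by rewrite addr_ge0//; apply: sumr_ge0.
pose d0 : probability R R := \d_(0 : R).
(* A shift by at most [C] is at most half of this standard deviation; the [+ 1] keeps it positive
   when [C] is 0. *)
pose N := centered_normal (2 * (C + 1)).
apply: (@distinguishes_overlap R d D sigma alpha g u v delta _ m alg
  (mixture d0 N) (mixture d0 N)) => //.
- exact: mixture_atom.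
- exact: mixture_atom.
rewrite -[4^-1]mul1r.
apply: (@overlap_glm_draw R d D _ _ sigma g u v [set x | l2norm x <= 1]) => //.
- rewrite (_ : [set _ | _] = (@l2norm R d) @^-1` `]-oo, 1]%classic); last first.
    by apply/seteqP; split => x /=; rewrite in_itv.
  rewrite -[X in measurable X]setTI.
  by apply: measurable_l2norm => //; exact: measurable_itv.
- by rewrite Dball.
move=> x /= x1.
have le_B w : \sum_(i < d) `|tnth w i| <= B -> - B <= dotp w x <= B.
  by move=> wB; rewrite -ler_norml (le_trans (dotp_le w x x1)).
have /andP[uB uB'] : - B <= dotp u x <= B.
  by apply: le_B; rewrite lerDl; apply: sumr_ge0.
have /andP[vB vB'] : - B <= dotp v x <= B.
  by apply: le_B; rewrite lerDr; apply: sumr_ge0.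
have gC : `|g (dotp u x) - g (dotp v x)| <= C.
  have := g_homo _ _ uB; have := g_homo _ _ uB'.
  have := g_homo _ _ vB; have := g_homo _ _ vB'.
  by rewrite ler_norml /C => *; apply/andP; split; lra.
have S0 : 0 < 2 * (C + 1) by lra.
(* The point masses at 0 contribute only the trivial overlap 0, the wide Gaussians contribute one
   half. *)
rewrite (_ : 4^-1 = (0 + 2^-1) / 2); last by lra.
apply: noise_overlap_mixture; first exact: overlap0.
apply: overlap_le (noise_overlap_normal sigma _ _ _ S0).
rewrite lerBrDr -lerBrDl ler_pdivrMr//.
by apply: le_trans gC _; lra.
Qed.

(** Taking logarithms gives [ln (1 / delta) - ln 2 <= r * m%:R]. Since [delta <= delta0 < 2^-1], the
    term [ln 2] is at most a fixed fraction, less than 1, of [ln (1 / delta)]. *)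
Lemma ln_sample_bound (delta0 delta q r : R) (m : nat) :
  0 < delta0 < 2^-1 -> 0 < delta <= delta0 ->
  expR (- r) <= q -> q ^+ m <= 2 * delta ->
  (1 - ln 2 / ln (1 / delta0)) * ln (1 / delta) <= r * m%:R.
Proof.
move=> /andP[delta00 delta02] /andP[delta_gt0 delta_le] rq qm.
have lnV (x : R) : 0 < x -> ln (1 / x) = - ln x.
  by move=> x0; rewrite div1r lnV ?posrE.
rewrite !lnV//.
have L0 : ln 2 < - ln delta0.
  rewrite ltrNr -lnV ?posrE// div1r ltr_ln ?posrE//.
have L1 : - ln delta0 <= - ln delta by rewrite lerN2 ler_ln ?posrE.
have ln2 : 0 <= ln 2 :> R by rewrite ln_ge0// ler1n.
have : - (r * m%:R) <= ln 2 + ln delta.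
  rewrite -lnM ?posrE// -ler_expR lnK ?posrE ?mulr_gt0//.
  apply: le_trans qm; rewrite -mulNr mulrC expRM_natl.
  by rewrite lerXn2r ?nnegrE ?expR_ge0// (le_trans _ rq) ?expR_ge0.
suff : ln 2 <= ln 2 / - ln delta0 * - ln delta by lra.
by rewrite mulrAC ler_pdivlMr ?ler_wpM2l//; lra.
Qed.

End sample_bounds.

Theorem theorem1p3 (R : realType) (delta0 : R) (hdelta0 : 0 < delta0 < 2^-1) :
  exists2 c : R, 0 < c &
    forall (d : nat) (radius sigma Delta tau alpha : R) (g : R -> R)
      (D : probability (d.-tuple R) R) (u v : d.-tuple R) (A : R),
    (1 <= d)%N -> 0 < radius -> 0 <= sigma -> 0 < Delta -> 0 < tau ->
    0 < alpha <= 2^-1 ->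
    1.-lipschitz g -> {homo g : s t / s <= t} ->
    supported_in_unit_ball D ->
    l2norm u <= radius -> l2norm v <= radius ->
    glm_separated D g Delta u v ->
    (gap_prob D g tau u v A <= tau%:E)%E ->
    forall (delta : R) (m : nat) (alg : @algorithm R d m),
    0 < delta <= delta0 ->
    distinguishes D g sigma alpha u v delta alg ->
    c * (Num.min sigma 1 * ln (1 / delta) / tau) <= m%:R.
Proof.
pose c0 : R := 1 - ln 2 / ln (1 / delta0).
have c0_gt0 : 0 < c0.
  have /andP[delta0_gt0 delta0_lt] := hdelta0.
  have ln2 : 0 < ln 2 :> R by rewrite ln_gt0// ltr1n.
  have lt0 : ln 2 < ln (1 / delta0).
    by rewrite ltr_ln ?posrE ?divr_gt0// ltr_pdivlMr//; lra.
  have lnV0 : 0 < ln (1 / delta0) by exact: lt_trans ln2 lt0.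
  by rewrite subr_gt0 ltr_pdivrMr// [ltRHS]mul1r.
(* The 16 comes from the case [s <= 4 * tau], where the rate 4 is at most [4 * (4 * tau / s)]. *)
exists (c0 / 16); first by rewrite divr_gt0.
move=> d radius sigma Delta tau alpha g D u v A _ _ sigma0 _ tau0 /andP[_ alpha2].
move=> _ g_homo Dball _ _ _ gap delta m alg hdelta dist.
have [sigma_gt0|sigma_le0] := ltP 0 sigma; last first.
  have -> : sigma = 0 by apply/eqP; rewrite eq_le sigma_le0.
  by rewrite min_l// !mul0r mulr0.
set s := Num.min sigma 1; set L := ln (1 / delta).
have s0 : 0 < s by rewrite lt_min sigma_gt0 ltr01.
have s_sigma : s <= sigma by rewrite ge_min lexx.
have s1 : s <= 1 by rewrite ge_min lexx orbT.
(* Common end of both cases: [r] is a rate for which the overlap of one sample is at least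
   [expR (- r)]. *)
have rate (r : R) : 0 <= r -> c0 * L <= r * m%:R -> r <= 16 * (tau / s) ->
    c0 / 16 * (s * L / tau) <= m%:R.
  move=> r0 h hr.
  rewrite (_ : c0 / 16 * (s * L / tau) = c0 * L * (s / tau) / 16); last by ring.
  rewrite ler_pdivrMr// -ler_pdivlMr ?divr_gt0// invf_div.
  apply: le_trans h _.
  rewrite (_ : m%:R * 16 * (tau / s) = 16 * (tau / s) * m%:R); last by ring.
  by rewrite ler_wpM2r.
have [tau_small|tau_large] := ltP (4 * tau) s.
- pose x := tau / s.
  have x0 : 0 < x by rewrite divr_gt0.
  have x4 : x <= 4^-1 by rewrite ler_pdivrMr//; lra.
  have tau_x : tau <= x by rewrite ler_pdivlMr// ler_piMr// ltW.
  have sigma_x : tau / sigma <= x.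
    by rewrite ler_pM2l// lef_pV2 ?posrE.
  have sigma_ge0 : 0 <= tau / sigma by rewrite divr_ge0// ltW.
  have tau_sigma : 0 <= tau <= sigma by apply/andP; split; lra.
  have tau1 : tau <= 1 by lra.
  have := distinguishes_gap D sigma tau alpha A g u v delta m alg g_homo
    sigma_gt0 tau_sigma tau1 alpha2 gap dist.
  move=> qm; apply: (rate (4 * x)); [lra| |rewrite -/x; lra].
  apply: ln_sample_bound hdelta0 hdelta _ qm.
  (* Both factors are at least [1 - x], so their product is at least [1 - 2 * x]. This exceeds
     [expR (- (4 * x))] because [(1 - 2 * x) * (1 + 4 * x) >= 1] for [0 <= x <= 4^-1]. *)
  apply: (@le_trans _ _ (1 - 2 * x)); last by nra.
  rewrite expRN -[leLHS]div1r ler_pdivrMr ?expR_gt0//.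
  have := expR_ge1Dx (4 * x); nra.
- have qm := distinguishes_bounded D sigma alpha g u v delta m alg g_homo alpha2
    Dball dist.
  apply: (rate 4) => //; last first.
    by rewrite -[leLHS]mulr1 (_ : 16 * _ = 4 * (4 * tau / s)); [
      rewrite ler_pM2l// ler_pdivlMr ?mul1r | ring].
  apply: ln_sample_bound hdelta0 hdelta _ qm.
  rewrite expRN lef_pV2 ?posrE ?expR_gt0//.
  by have := expR_ge1Dx (4 : R); lra.
Qed.
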